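(* Let $r>0$, let $c_1:=c_{{\rm H},+\infty,r}$, and let $c_2:=c_{{\rm H},+\infty,r}+c_{p,0}$ for some real polynomial function $p:\mathbb{R}\to\mathbb{R}$ which is non-constant and always positive, such as $p(x)=x^2+1$. Then one has a case with the following properties. \begin{enumerate} \item $c_1$ and $c_2$ are $\mathbb{R}$-$\mathbb{R}$ TS functions with $c_1(x)<c_2(x)$ for all $x\in\mathbb{R}$, and $c_1(S(c_1))\cup c_2(S(c_2))$ is a discrete and closed subset of $\mathbb{R}$. \item The set $S(c_1)\cup S(c_2)\subset\mathbb{R}$ is unbounded. \item Both $c_1(x)$ and $c_2(x)$ diverge to $+\infty$ as $x$ diverges to $-\infty$. \item Both $c_1(x)$ and $c_2(x)$ diverge to $+\infty$ as $x$ diverges to $+\infty$. \end{enumerate}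
   Context: For a differentiable function $c$, $S(c)$ denotes its set of critical points. An $\mathbb{R}$-$\mathbb{R}$ TS function is a smooth function $c:\mathbb{R}\to\mathbb{R}$ whose critical set $S(c)$ is a disjoint union of finitely many (possibly none) or countably many sets each of which is a one-point set or a copy of $D^1=[-1,1]$, $\{t\ge0\}$, or $\mathbb{R}$. For $r>0$, $c_{{\rm H},+\infty,r}:\mathbb{R}\to\mathbb{R}$ is the unique smooth function whose graph $\{(c_{{\rm H},+\infty,r}(x),x)\mid x\in\mathbb{R}\}$ is a connected component of a hyperbola congruent to $\{(x_1,x_2)\in\mathbb{R}^2\mid x_1^2-rx_2^2=1\}$, which diverges to $+\infty$ at $\pm\infty$, is even, has minimum $1$ and has $0$ as its only critical point, and whose first derivative is bounded and has no critical points; explicitly, $c_{{\rm H},+\infty,r}(x)=\sqrt{1+rx^2}$. For an everywhere positive non-constant real polynomial function $p$, $c_{p,0}(x):=\dfrac{2+\sin(e^{x^2})}{p(x)}$. *)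

(* Defs.v *)
From HB Require Import structures.
From mathcomp Require Import all_boot all_order all_algebra.
From mathcomp Require Import all_classical all_reals all_analysis.
Import Order.TTheory GRing.Theory Num.Theory.
Import numFieldNormedType.Exports.

Set Implicit Arguments.
Unset Strict Implicit.
Unset Printing Implicit Defensive.

Local Open Scope classical_set_scope.
Local Open Scope ring_scope.

Definition smooth (R : realType) (c : R -> R) : Prop :=
  forall (n : nat) (x : R), derivable (derive1n n c) x 1.

(* [is_derive] entails derivability, so points where [c] fails to be
   differentiable are never critical, whatever the default value of [c^`()]. *)
Definition critical_set (R : realType) (c : R -> R) : set R :=
  [set x | is_derive x (1 : R) c 0].

(* Homeomorphism of [A] and [B] for their subspace topologies. *)
Definition copy_of (R : realType) (A B : set R) : Prop :=
  exists f g : R -> R,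
    [/\ {within A, continuous f}, {within B, continuous g},
        f @` A = B, g @` B = A & {in A, cancel f g}].

(* The critical set is partitioned by a countable (possibly finite or empty)
   set [F] of pieces. *)
Definition TS_function (R : realType) (c : R -> R) : Prop :=
  smooth c /\
  exists F : set (set R),
    [/\ countable F, trivIset F id, \bigcup_(A in F) A = critical_set c &
        forall A, F A ->
          [\/ exists x, A = [set x],
              copy_of A `[(-1 : R), 1],
              copy_of A `[(0 : R), +oo[ |
              copy_of A setT]].

(* Every point is isolated, i.e. the subspace topology on [A] is discrete. *)
Definition discrete_subset (R : realType) (A : set R) : Prop :=
  A `<=` isolated A.

(* The component [x1 > 0] of the hyperbola [x1 ^ 2 - r * x2 ^ 2 = 1], viewed as
   a graph [x1 = c x2] over the second coordinate. *)
Definition c_hyperbola (R : realType) (r : R) (x : R) : R :=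
  Num.sqrt (1 + r * x ^+ 2).

Definition c_oscillating (R : realType) (p : {poly R}) (x : R) : R :=
  (2 + sin (expR (x ^+ 2))) / p.[x].

(* Main.v *)
(* The functions x, exp(x^2), sin(exp(x^2)), cos(exp(x^2)), h = sqrt(1 + r x^2),
   1/h and 1/p are bounded near every point and their derivatives are
   polynomials in themselves. Differentiating a polynomial of degree k in them
   raises the degree by a constant and multiplies the size of the coefficients
   by O(k), so every such polynomial f satisfies |f^(n)| <= C K^n n! locally.
   This is a form of analyticity sufficient for the identity theorem, which
   applies to the derivative of c2: c2 is not constant, hence its critical points
   do not accumulate. As c1 and c2 are proper, neither do the critical values.
   The critical points of c2 are unbounded because, when exp(x^2) is a large
   multiple of pi, the term 2 x exp(x^2) cos(exp(x^2)) / p(x) dominates c2'(x)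
   and its sign alternates. *)

Require Import Defs.
From HB Require Import structures.
From mathcomp Require Import all_boot all_order all_algebra.
From mathcomp Require Import all_classical all_reals all_analysis.
From mathcomp Require Import ring lra zify polyrcf.
Import Order.TTheory GRing.Theory Num.Theory.
Import numFieldNormedType.Exports.
Local Open Scope classical_set_scope.
Local Open Scope ring_scope.

Set Implicit Arguments.
Unset Strict Implicit.
Unset Printing Implicit Defensive.

(** * Derivatives of polynomials in a differentially closed family *)

(* [generated_poly s k w f]: [f] is a polynomial in the members of [s] of degree
   at most [k] whose coefficients have absolute values of sum at most [w]. *)
Inductive generated_poly (R : realType) (s : list (R -> R)) :
    nat -> R -> (R -> R) -> Prop :=
| GenConst c : generated_poly s 0 `|c| (fun=> c)
| GenVar g : List.In g s -> generated_poly s 1 1 g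
| GenAdd k w v f g : generated_poly s k w f -> generated_poly s k v g ->
    generated_poly s k (w + v) (fun x => f x + g x)
| GenMul k l w v f g : generated_poly s k w f -> generated_poly s l v g ->
    generated_poly s (k + l) (w * v) (fun x => f x * g x)
| GenWeaken k l w v f : (k <= l)%N -> w <= v ->
    generated_poly s k w f -> generated_poly s l v f.

Lemma generated_poly_weight_ge0 (R : realType) (s : list (R -> R)) k w f :
  generated_poly s k w f -> 0 <= w.
Proof.
elim=> {k w f} // [k w v f g _ w0 _ v0|k l w v f g _ w0 _ v0|k l w v f _ wv _ w0].
- exact: addr_ge0.
- exact: mulr_ge0.
- exact: le_trans wv.
Qed.

(** The condition [1 <= M] makes [M ^+ k] monotone in [k], as the weakening rule demands. *)
Lemma generated_poly_bound (R : realType) (s : list (R -> R)) k w f (M x : R) :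
  1 <= M -> (forall g, List.In g s -> `|g x| <= M) ->
  generated_poly s k w f -> `|f x| <= w * M ^+ k.
Proof.
move=> M1 sM; elim=> {k w f}
  [c|g gs|k w v f g _ fM _ gM|k l w v f g _ fM _ gM|k l w v f kl wv f_gen fM].
- by rewrite mulr1.
- by rewrite mul1r; exact: sM.
- by rewrite mulrDl (le_trans (ler_normD _ _))// lerD.
- by rewrite normrM exprD mulrACA ler_pM.
- apply: (le_trans fM); apply: ler_pM => //.
  + exact: generated_poly_weight_ge0 f_gen.
  + by rewrite exprn_ge0// (le_trans ler01).
  + by rewrite ler_weXn2l.
Qed.

Definition closed_under_derivation (R : realType) (s : list (R -> R)) : Prop :=
  forall g, List.In g s -> exists k w dg,
    generated_poly s k w dg /\ forall x, is_derive x (1 : R) g (dg x).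

(** Finiteness of the list gives one degree and one weight for all generators. The degree is written
    [d.+1] because replacing a factor by its derivative then raises the total degree by exactly
    [d]. *)
Lemma generated_poly_derive_gens (R : realType) (s : list (R -> R)) :
  closed_under_derivation s ->
  exists d B, 0 <= B /\ forall g, List.In g s -> exists dg,
    generated_poly s d.+1 B dg /\ forall x, is_derive x (1 : R) g (dg x).
Proof.
(* Only the list that [g] ranges over is generalized for the induction; the polynomials stay over
   the whole of [s]. *)
rewrite /closed_under_derivation; move: {1 3}s => t.
elim: t => [|h t IH] ht; first by exists 0%N, 0.
have [|d [B [B0 dB]]] := IH; first by move=> g gt; apply: ht; right.
have [|k [w [dh [dh_gen dhE]]]] := ht h; first by left.
have w0 := generated_poly_weight_ge0 dh_gen.
exists (d + k)%N, (B + w); split=> [|g [<-|/dB[dg [dg_gen dgE]]]].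
- exact: addr_ge0.
- exists dh; split=> //; apply: GenWeaken dh_gen; last by rewrite lerDr.
  by rewrite -addSn leq_addl.
- exists dg; split=> //; apply: GenWeaken dg_gen; last by rewrite lerDl.
  by rewrite ltnS leq_addr.
Qed.

(** By the Leibniz rule a monomial of degree at most [k] yields at most [k] terms, each with one
    factor replaced by a polynomial of weight [B]; hence the factor [k%:R * B]. *)
Lemma generated_poly_derive (R : realType) (s : list (R -> R)) d B :
  0 <= B ->
  (forall g, List.In g s -> exists dg,
    generated_poly s d.+1 B dg /\ forall x, is_derive x (1 : R) g (dg x)) ->
  forall k w f, generated_poly s k w f ->
  exists df, generated_poly s (k + d) (k%:R * B * w) df /\
             forall x, is_derive x (1 : R) f (df x).
Proof.
move=> B0 dB k w f; elim=> {k w f}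
  [c|g gs|k w v f g _ [df [df_gen dfE]] _ [dg [dg_gen dgE]]
  |k l w v f g f_gen [df [df_gen dfE]] g_gen [dg [dg_gen dgE]]
  |k l w v f kl wv f_gen [df [df_gen dfE]]].
- exists (fun=> 0); split; last by move=> x; exact: is_derive_cst.
  by apply: GenWeaken (GenConst s 0); rewrite ?normr0 ?mul0r.
- have [dg [dg_gen dgE]] := dB g gs.
  by exists dg; split=> //; rewrite mul1r mulr1 add1n.
- exists (fun x => df x + dg x); split; first by rewrite mulrDr; exact: GenAdd.
  by move=> x; exact: is_deriveD.
- exists (fun x => f x * dg x + g x * df x); split; last first.
    by move=> x; exact: is_deriveM.
  have -> : (k + l)%:R * B * (w * v) =
      w * (l%:R * B * v) + v * (k%:R * B * w) by rewrite natrD; ring.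
  apply: GenAdd; first by rewrite -addnA; exact: GenMul.
  by rewrite (addnC k) -addnA; exact: GenMul.
- exists df; split=> //; apply: GenWeaken df_gen; first by rewrite leq_add2r.
  apply: ler_pM => //.
  + by rewrite mulr_ge0.
  + exact: generated_poly_weight_ge0 f_gen.
  + by rewrite ler_wpM2r// ler_nat.
Qed.

Section generated_poly_iterate.
Context (R : realType) (s : list (R -> R)) (d : nat) (B : R).
Hypotheses (B0 : 0 <= B) (dB : forall g, List.In g s -> exists dg,
    generated_poly s d.+1 B dg /\ forall x, is_derive x (1 : R) g (dg x)).

(** Before differentiation number [i], counted from 0, the degree is [k + i * d]; these degrees
    accumulate as the product. *)
Lemma generated_poly_derive1n k w f n : generated_poly s k w f ->
  generated_poly s (k + n * d)
    (\prod_(i < n) (k + i * d)%:R * B ^+ n * w) (derive1n n f).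
Proof.
move=> f_gen; elim: n => [|n IH].
  by rewrite big_ord0 expr0 !mul1r mul0n addn0.
have [df [df_gen dfE]] := generated_poly_derive B0 dB IH.
rewrite derive1nS; have -> : (f^`(n))^`()%classic = df.
  by apply/funext => x; rewrite derive1E (@derive_val _ _ _ _ _ _ _ (dfE x)).
apply: GenWeaken df_gen; first by rewrite mulSn addnCA addnC addnA.
by rewrite big_ord_recr/= exprS le_eqVlt; apply/orP; left; apply/eqP; ring.
Qed.

End generated_poly_iterate.

Lemma generated_poly_smooth (R : realType) (s : list (R -> R)) k w f :
  closed_under_derivation s -> generated_poly s k w f -> smooth f.
Proof.
move=> /generated_poly_derive_gens[d [B [B0 dB]]] f_gen n x.
have fn_gen := generated_poly_derive1n B0 dB n f_gen.
have [df [_ dfE]] := generated_poly_derive B0 dB fn_gen.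
exact: (@ex_derive _ _ _ _ _ _ _ (dfE x)).
Qed.

(** For smooth functions this is the classical derivative estimate characterizing real analyticity
    (Gevrey order 1). The constants are uniform in [n] and over a neighbourhood of [z]. *)
Definition locally_gevrey (R : realType) (f : R -> R) : Prop :=
  forall z : R, exists C K : R, [/\ 0 <= C, 0 <= K &
    \forall x \near z, forall n, `|derive1n n f x| <= C * K ^+ n * n`!%:R].

Lemma near_bounded_gens (R : realType) (s : list (R -> R)) (z : R) :
  (forall g, List.In g s -> {for z, continuous g}) ->
  exists M, 1 <= M /\ \forall x \near z, forall g, List.In g s -> `|g x| <= M.
Proof.
elim: s => [|h t IH] sc; first by exists 1; split=> //; near=> x => g [].
have [|M [M1 tM]] := IH; first by move=> g gt; apply: sc; right.
have hc : {for z, continuous h} by apply: sc; left.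
have hz : \forall x \near z, `|h x| <= 1 + `|h z|.
  near=> x; rewrite -lerBlDr (le_trans (lerB_dist _ _))// distrC ltW//.
  near: x; by move/cvgrPdist_lt: hc; apply.
exists (M + `|h z|); split; first by rewrite (le_trans M1)// lerDl.
near=> x => g [<-|gt].
- have /le_trans : `|h x| <= 1 + `|h z| by near: x.
  by apply; rewrite lerD2r.
- rewrite ler_wpDr//; move: g gt; near: x; exact: tM.
Unshelve. all: by end_near. Qed.

Lemma generated_poly_gevrey (R : realType) (s : list (R -> R)) k w f :
  closed_under_derivation s -> generated_poly s k w f -> locally_gevrey f.
Proof.
move=> s_closed f_gen z.
have sc g : List.In g s -> {for z, continuous g}.
  move=> /s_closed[_ [_ [dg [_ dgE]]]].
  exact/differentiable_continuous/derivable1_diffP/(@ex_derive _ _ _ _ _ _ _ (dgE z)).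
have [M [M1 sM]] := near_bounded_gens sc.
have [d [B [B0 dB]]] := generated_poly_derive_gens s_closed.
have w0 := generated_poly_weight_ge0 f_gen.
have M0 : 0 <= M by rewrite (le_trans ler01).
exists (w * M ^+ k), ((k + d)%:R * B * M ^+ d); split.
- by rewrite mulr_ge0// exprn_ge0.
- by rewrite !mulr_ge0// exprn_ge0.
near=> x => n.
have gM : forall g, List.In g s -> `|g x| <= M by near: x.
have := generated_poly_bound M1 gM
  (generated_poly_derive1n B0 dB n f_gen).
move=> /le_trans; apply.
(* Each factor satisfies [k + i * d <= (k + d) * i.+1], which is where the factorial comes from. *)
have prod_le : \prod_(i < n) (k + i * d)%:R <= (k + d)%:R ^+ n * n`!%:R :> R.
  elim: n => [|n IH]; first by rewrite big_ord0 expr0 mul1r.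
  rewrite big_ord_recr/= exprSr factS natrM [n.+1%:R * _]mulrC mulrACA ler_pM//.
    by apply: prodr_ge0.
  rewrite -natrM ler_nat; nia.
have -> : w * M ^+ k * ((k + d)%:R * B * M ^+ d) ^+ n * n`!%:R =
    (k + d)%:R ^+ n * n`!%:R * (B ^+ n * w * M ^+ (k + n * d)).
  by rewrite !exprMn exprD (mulnC n) exprM; ring.
rewrite -!mulrA [leRHS]mulrA ler_wpM2r//.
  by rewrite !mulr_ge0// exprn_ge0.
Unshelve. all: by end_near. Qed.

(** * The identity theorem *)

Lemma smooth_is_derive (R : realType) (f : R -> R) n x :
  smooth f -> is_derive x (1 : R) (derive1n n f) (derive1n n.+1 f x).
Proof.
by move=> f_smooth; apply: DeriveDef; [exact: f_smooth|rewrite derive1nS derive1E].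
Qed.

Lemma smooth_derive (R : realType) (f : R -> R) : smooth f -> smooth f^`()%classic.
Proof. by move=> f_smooth n x; rewrite -derive1Sn; exact: f_smooth. Qed.

Lemma smooth_continuous (R : realType) (f : R -> R) : smooth f -> continuous f.
Proof.
by move=> f_smooth x; exact/differentiable_continuous/derivable1_diffP/(f_smooth 0%N).
Qed.

Definition zeros (R : realType) (f : R -> R) : set R := [set x | f x = 0].

Lemma limit_point_zeros_sub (R : realType) (f : R -> R) :
  continuous f -> limit_point (zeros f) `<=` zeros f.
Proof.
move=> fc; apply: (subset_trans (@subset_limit_point _ _)).
apply: (@preimage_closed _ _ f [set 0]) => [x _|].
  exact: fc.
exact: closed_eq.
Qed.

(** The limit point [z] is itself a zero, so Rolle applies between [z] and any nearby zero [y]. The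
    point found lies strictly between them, hence differs from [z] and stays in the same ball. *)
Lemma limit_point_zeros_derive (R : realType) (f : R -> R) : smooth f ->
  limit_point (zeros f) `<=` limit_point (zeros f^`()%classic).
Proof.
move=> f_smooth z zl U zU.
have fz := limit_point_zeros_sub (smooth_continuous f_smooth) zl.
have /nbhs_ballP[e /= e0 eU] := zU.
have [y [yz fy ye]] := zl _ (nbhsx_ballx z e e0).
have rolle a b : a < b -> f a = f b ->
    exists2 c, c \in `]a, b[ & f^`()%classic c = 0.
  move=> ab fab; have [|||c cab cE] := @Rolle _ f a b ab; last first.
  - by exists c => //; rewrite derive1E; exact: (@derive_val _ _ _ _ _ _ _ cE).
  - exact: fab.
  - exact/continuous_subspaceT/smooth_continuous.
  - by move=> x _; exact: (f_smooth 0%N).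
move: ye; rewrite /ball/= => ye.
have [yz'|zy'|//] := ltgtP y z; last by move=> yz'; rewrite yz' eqxx in yz.
- have [c] := rolle y z yz' (etrans fy (esym fz)).
  rewrite in_itv/= => /andP[yc cz] dc; exists c; split => //.
    by rewrite lt_eqF.
  by apply: eU; rewrite /ball/=; move: ye; rewrite !ger0_norm; lra.
- have [c] := rolle z y zy' (etrans fz (esym fy)).
  rewrite in_itv/= => /andP[zc cy] dc; exists c; split => //.
    by rewrite gt_eqF.
  by apply: eU; rewrite /ball/=; move: ye; rewrite !ler0_norm; lra.
Qed.

Lemma limit_point_zeros_derive1n (R : realType) (f : R -> R) z n : smooth f ->
  limit_point (zeros f) z -> derive1n n f z = 0.
Proof.
elim: n f => [|n IH] f f_smooth zl.
  exact: (limit_point_zeros_sub (smooth_continuous f_smooth)).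
rewrite derive1Sn; apply: IH; first exact: smooth_derive.
exact: limit_point_zeros_derive.
Qed.

(* Integrating the bound on the derivative of order [n + j] step by step keeps
   the factor [1 / j!], which the mean value theorem alone would lose. *)
Lemma taylor_bound_right (R : realType) (F : nat -> R -> R) (z b B : R) j n :
  (forall n x, is_derive x (1 : R) (F n) (F n.+1 x)) ->
  (forall n, F n z = 0) ->
  (forall x, z <= x <= b -> `|F (n + j)%N x| <= B) ->
  forall x, z <= x <= b -> `|F n x| <= B * (x - z) ^+ j / j`!%:R.
Proof.
move=> dF Fz; elim: j n => [|j IH] n FB x /andP[zx xb].
  by rewrite expr0 mulr1 divr1; move: (FB x); rewrite addn0 zx xb; apply.
have {}FB : forall t, z <= t <= b -> `|F n.+1 t| <= B * (t - z) ^+ j / j`!%:R.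
  by apply: IH => t; rewrite addSnnS; exact: FB.
have dpow t : is_derive t (1 : R)
    (fun t => B * (t - z) ^+ j.+1 / j.+1`!%:R) (B * (t - z) ^+ j / j`!%:R).
  have -> : (fun t => B * (t - z) ^+ j.+1 / j.+1`!%:R) =
      (B / j.+1`!%:R) \*: (id - cst z) ^+ j.+1.
    by apply/funext => u; rewrite /GRing.scale/= exprfctE mulrAC.
  have j0 : j`!%:R != 0 :> R by rewrite pnatr_eq0 -lt0n fact_gt0.
  apply: is_derive_eq; rewrite /GRing.scale/= factS natrM !fctE/=.
  have : j.+1%:R != 0 :> R by rewrite pnatr_eq0.
  by move: (j.+1%:R : R) => a a0; field; rewrite j0 a0.
(* The signs [e = 1] and [e = -1] together bound the absolute value. The difference [G] of the two
   sides vanishes at [z] and has nonnegative derivative on the segment. *)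
have side (e : R) : `|e| = 1 -> e * F n x <= B * (x - z) ^+ j.+1 / j.+1`!%:R.
  move=> e1.
  pose G := fun t => B * (t - z) ^+ j.+1 / j.+1`!%:R - e * F n t.
  pose dG := fun t => B * (t - z) ^+ j / j`!%:R - e * F n.+1 t.
  have GE t : is_derive t (1 : R) G (dG t).
    by apply: is_deriveB; exact: is_deriveZ.
  have [|c] := @MVT_segment _ G dG z x zx (fun t _ => GE t).
    apply: continuous_subspaceT => t.
    exact/differentiable_continuous/derivable1_diffP/(@ex_derive _ _ _ _ _ _ _ (GE t)).
  rewrite in_itv/= => /andP[zc cx].
  rewrite {1 2}/G Fz subrr expr0n/= !mulr0 mul0r subr0 subr0 => Gx.
  rewrite -subr_ge0 Gx mulr_ge0 ?subr_ge0//.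
  apply: le_trans (FB c _); last by rewrite zc (le_trans cx).
  by rewrite (le_trans (ler_norm _))// normrM e1 mul1r.
rewrite ler_norml; apply/andP; split.
  by have := side (-1); rewrite normrN1 mulN1r => /(_ erefl); rewrite lerNl.
by have := side 1; rewrite normr1 mul1r; apply.
Qed.

Lemma geometric_bound_eq0 (R : realType) (y C t : R) :
  0 <= t < 1 -> (forall j, `|y| <= C * t ^+ j) -> y = 0.
Proof.
move=> /andP[t0 t1] yC; apply/normr0_eq0/le_anti; rewrite normr_ge0 andbT.
have Ct : (C * t ^+ j) @[j --> \oo] --> C * 0.
  by apply: cvgMr; apply: cvg_expr; rewrite ger0_norm.
by rewrite mulr0 in Ct; apply: (cvgr_to_ge Ct); exact: nearW.
Qed.

(** The factorials of the Gevrey and Taylor bounds cancel, leaving [C * (K * (x - z)) ^+ j] for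
    every [j], which tends to 0 near [z]. Stating it for a sequence [F] lets it serve a reflected
    function as well. *)
Lemma eq0_near_right (R : realType) (F : nat -> R -> R) (z : R) :
  (forall n x, is_derive x (1 : R) (F n) (F n.+1 x)) ->
  (forall n, F n z = 0) ->
  (exists C K : R, [/\ 0 <= C, 0 <= K &
    \forall x \near z, forall n, `|F n x| <= C * K ^+ n * n`!%:R]) ->
  exists2 e : R, 0 < e & forall x, z <= x < z + e -> F 0%N x = 0.
Proof.
move=> dF Fz [C [K [C0 K0 /nbhs_ballP[e /= e0 eF]]]].
(* The radius forces [K * (x - z) < 1]; using [K + 1] avoids inverting 0 when [K = 0]. *)
exists (Num.min e (K + 1)^-1) => [|x /andP[zx xe]].
  by rewrite lt_min e0 invr_gt0; lra.
have [xe1 xe2] : x - z < e /\ x - z < (K + 1)^-1.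
  by move: xe; rewrite -ltrBlDl lt_min => /andP[].
apply: (@geometric_bound_eq0 _ _ C (K * (x - z))) => [|j].
  rewrite mulr_ge0 ?subr_ge0//=.
  apply: (@le_lt_trans _ _ ((K + 1) * (x - z))); first by rewrite ler_wpM2r; lra.
  by rewrite mulrC -lter_pdivlMr ?mul1r//; lra.
have j0 : j`!%:R != 0 :> R by rewrite pnatr_eq0 -lt0n fact_gt0.
have -> : C * (K * (x - z)) ^+ j = C * K ^+ j * j`!%:R * (x - z) ^+ j / j`!%:R.
  by rewrite exprMn; field.
apply: (@taylor_bound_right _ F z x _ j 0 dF Fz); last by rewrite zx lexx.
move=> t /andP[zt tx]; rewrite add0n; apply: eF.
by rewrite /ball/= ler0_norm; lra.
Qed.

Lemma eq0_near (R : realType) (f : R -> R) (z : R) :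
  smooth f -> locally_gevrey f -> (forall n, derive1n n f z = 0) ->
  \forall x \near z, f x = 0.
Proof.
move=> f_smooth f_gevrey fz.
have df n x : is_derive x (1 : R) (derive1n n f) (derive1n n.+1 f x).
  exact: smooth_is_derive.
have [e e0 fe] := eq0_near_right df fz (f_gevrey z).
have [C [K [C0 K0 fCK]]] := f_gevrey z.
(* These are the successive derivatives of the reflection of [f], so the right-hand result at [- z]
   covers the left side of [z]. *)
pose g n x : R := (-1) ^+ n * derive1n n f (- x).
have dg n x : is_derive x (1 : R) (g n) (g n.+1 x).
  have dfN : is_derive x (1 : R) (derive1n n f \o -%R) (derive1n n.+1 f (- x) * -1).
    exact: is_derive1_comp.
  apply: (@is_derive_eq _ _ _ _ _ _ _ ((-1) ^+ n *: (derive1n n.+1 f (- x) * -1))).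
  by rewrite /g exprSr /GRing.scale/=; ring.
have [||e' e'0 ge] := @eq0_near_right _ g (- z) dg.
- by move=> n; rewrite /g opprK fz mulr0.
- exists C, K; split=> //.
  have zc : - x @[x --> - z] --> z by rewrite -[X in _ --> X]opprK; exact: opp_continuous.
  have fNCK : \forall x \near - z, forall n,
      `|derive1n n f (- x)| <= C * K ^+ n * n`!%:R := zc _ fCK.
  near=> x => n; rewrite /g normrM normrX normrN1 expr1n mul1r.
  by move: n; near: x.
apply/nbhs_ballP; exists (Num.min e e') => /= [|x]; first by rewrite lt_min e0.
rewrite /ball/= lt_min => /andP[xe xe'].
have [zx|xz] := leP z x.
  by apply: fe; rewrite zx/=; move: xe; rewrite ler0_norm; lra.
have := ge (- x); rewrite /g expr0 mul1r opprK; apply.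
by move: xe'; rewrite ger0_norm; lra.
Unshelve. all: by end_near. Qed.

(* By Rolle, a limit point of zeros is a zero of infinite order, hence an
   interior point of the zero set: the limit points form a clopen set. *)
Lemma gevrey_eq0 (R : realType) (f : R -> R) :
  smooth f -> locally_gevrey f -> limit_point (zeros f) !=set0 ->
  forall x, f x = 0.
Proof.
move=> f_smooth f_gevrey zl x.
suff lT : limit_point (zeros f) = setT.
  by apply: (limit_point_zeros_sub (smooth_continuous f_smooth)); rewrite lT.
have RC : connected [set: R] by apply/connected_intervalP => a b _ _ c _.
apply: RC => //.
  exists (limit_point (zeros f)); last by rewrite setTI.
  rewrite openE => z zlim; rewrite /interior.
  have /nbhs_ballP[e /= e0 fe] := eq0_near f_smooth f_gevrey
    (fun n => limit_point_zeros_derive1n n f_smooth zlim).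
  apply/nbhs_ballP; exists e => //= y ye=> U /nbhs_ballP[d /= d0 dU].
  (* The zero [y + m / 2] differs from [y]; the bound [d] keeps it in [U] and the bound
     [e - |z - y|] keeps it in the ball where [f] vanishes. *)
  have m0 : 0 < Num.min d (e - `|z - y|) by rewrite lt_min d0 subr_gt0.
  have [md me] : Num.min d (e - `|z - y|) <= d /\ Num.min d (e - `|z - y|) <= e - `|z - y|.
    by split; rewrite ge_min lexx ?orbT.
  set m := Num.min _ _ in m0 md me; exists (y + m / 2); split.
  - by rewrite gt_eqF// ltrDl divr_gt0.
  - apply: fe; rewrite /ball/= opprD addrA.
    rewrite (le_lt_trans (ler_normB _ _))// (@ger0_norm _ (m / 2)); lra.
  - by apply: dU; rewrite /ball/= opprD addrA subrr sub0r normrN ger0_norm; lra.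
exists (limit_point (zeros f)); last by rewrite setTI.
exact/limit_point_closed/hausdorff_accessible/norm_hausdorff.
Qed.

(** * Sets without limit points *)

Lemma no_limit_point_isolated (R : realType) (A : set R) :
  limit_point A = set0 -> A `<=` isolated A.
Proof.
by move=> A0 x /subset_closure; rewrite closure_isolated_limit_point A0 setU0.
Qed.

Lemma no_limit_point_closed (R : realType) (A : set R) :
  limit_point A = set0 -> closed A.
Proof.
move=> A0; rewrite /closed closure_isolated_limit_point A0 setU0.
exact: isolatedS.
Qed.

(** In the real line a limit point has infinitely many points of the set in each neighbourhood, so
    neighbourhoods meeting [A] and [B] finitely often can be intersected. *)
Lemma limit_point_setU (R : realType) (A B : set R) :
  limit_point A = set0 -> limit_point B = set0 -> limit_point (A `|` B) = set0.
Proof.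
move=> A0 B0; apply/seteqP; split=> // x /limit_point_infinite_setP xAB.
have fin (C : set R) : limit_point C = set0 ->
    exists2 U, nbhs x U & finite_set (U `&` C).
  move=> C0; apply/not_exists2P => CU.
  suff : limit_point C x by rewrite C0.
  by apply/limit_point_infinite_setP => U xU; have [|] := CU U.
have [[U xU UA] [V xV VB]] := (fin A A0, fin B B0).
apply: (xAB _ (filterI xU xV)).
apply: (@sub_finite_set _ _ ((U `&` A) `|` (V `&` B))); last by rewrite finite_setU.
by move=> y [[Uy Vy] [Ay|By]]; [left|right].
Qed.

(** Infinitely many values near [y] come from infinitely many points of [A]. Properness keeps these
    points bounded, so they accumulate by Bolzano-Weierstrass. *)
Lemma image_no_limit_point (R : realType) (f : R -> R) (A : set R) :
  (forall M, exists N, forall x, `|f x| <= M -> `|x| <= N) ->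
  limit_point A = set0 -> limit_point (f @` A) = set0.
Proof.
move=> f_proper A0; apply/seteqP; split=> // y /limit_point_infinite_setP yfA.
pose B := A `&` [set x | `|f x| <= `|y| + 1].
have : infinite_set B.
  move=> /(finite_image f) fB; apply: (yfA _ (nbhsx_ballx y 1 ltr01)).
  apply: sub_finite_set fB => fx [/[swap] -[x Ax <-] yx]; exists x => //; split=> //=.
  move: yx; rewrite /ball/= distrC => /ltW yx.
  by rewrite -[f x](subrK y) (le_trans (ler_normD _ _))// addrC lerD2l.
move=> /infinite_bounded_limit_point_nonempty[|x].
  have [N fN] := f_proper (`|y| + 1).
  exists N; split=> [|M NM x [_ /= /fN xN]]; first exact: num_real.
  exact: le_trans (ltW NM).
move=> Bx; suff : limit_point A x by rewrite A0.
by move=> U /Bx[z [zx [Az _] Uz]]; exists z.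
Qed.

Lemma critical_setE (R : realType) (f : R -> R) : smooth f ->
  critical_set f = zeros f^`()%classic.
Proof.
move=> f_smooth; apply/seteqP; split=> x; rewrite /critical_set /zeros/=.
  by move=> fx; rewrite derive1E; exact: (@derive_val _ _ _ _ _ _ _ fx).
move=> fx0; apply: DeriveDef; first exact: (f_smooth 0%N).
by rewrite -derive1E.
Qed.

Lemma TS_function_no_limit_point (R : realType) (f : R -> R) : smooth f ->
  limit_point (critical_set f) = set0 -> TS_function f.
Proof.
move=> f_smooth f0; split=> //; exists (set1 @` critical_set f); split.
(* The pieces are singletons; all critical points are isolated, and a set of reals has only
   countably many isolated points. *)
- apply: sub_countable (card_image_le _ _) _; apply: sub_countable (countable_isolated (critical_set f)).
  exact/subset_card_le/no_limit_point_isolated.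
- by move=> _ _ [x _ <-] [y _ <-] [z [/= -> ->]].
- by apply/seteqP; split=> [x [_ [y fy <-] ->]//|x fx]; exists [set x] => //; exists x.
- by move=> _ [x _ <-]; constructor 1; exists x.
Qed.

(** Accumulating critical points would make the derivative vanish identically by the identity
    theorem, so [f] would be constant. *)
Lemma gevrey_critical_set (R : realType) (f : R -> R) (x y : R) :
  smooth f -> locally_gevrey f^`()%classic -> f x <> f y ->
  limit_point (critical_set f) = set0.
Proof.
move=> f_smooth f_gevrey fxy; apply/seteqP; split=> // z.
rewrite critical_setE// => zl; apply: fxy; apply: is_derive_0_is_cst => t.
have := @smooth_is_derive _ _ 0 t f_smooth.
by rewrite derive1n1 (gevrey_eq0 (smooth_derive f_smooth))//; exists z.
Qed.

Lemma generated_poly_derive_gevrey (R : realType) (s : list (R -> R)) k w f :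
  closed_under_derivation s -> generated_poly s k w f ->
  locally_gevrey f^`()%classic.
Proof.
move=> s_closed f_gen.
have [d [B [B0 dB]]] := generated_poly_derive_gens s_closed.
have f1_gen := generated_poly_derive1n B0 dB 1%N f_gen.
by rewrite -derive1n1; exact: generated_poly_gevrey s_closed f1_gen.
Qed.

(** * The functions of the example *)

Definition generated (R : realType) (s : list (R -> R)) (f : R -> R) : Prop :=
  exists k w, generated_poly s k w f.

Lemma generatedC (R : realType) (s : list (R -> R)) c : generated s (fun=> c).
Proof. by exists 0%N, `|c|; exact: GenConst. Qed.

Lemma generatedV (R : realType) (s : list (R -> R)) g :
  List.In g s -> generated s g.
Proof. by exists 1%N, 1; exact: GenVar. Qed.

Lemma generatedD (R : realType) (s : list (R -> R)) f g :
  generated s f -> generated s g -> generated s (fun x => f x + g x).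
Proof.
move=> [k [w f_gen]] [l [v g_gen]]; exists (k + l)%N, (w + v); apply: GenAdd.
- by apply: GenWeaken f_gen; rewrite ?leq_addr.
- by apply: GenWeaken g_gen; rewrite ?leq_addl.
Qed.

Lemma generatedM (R : realType) (s : list (R -> R)) f g :
  generated s f -> generated s g -> generated s (fun x => f x * g x).
Proof.
move=> [k [w f_gen]] [l [v g_gen]]; exists (k + l)%N, (w * v); exact: GenMul.
Qed.

Lemma generated_horner (R : realType) (s : list (R -> R)) (p : {poly R}) :
  List.In id s -> generated s (horner p).
Proof.
move=> ids; elim/poly_ind: p => [|p c IH].
  have -> : horner (0 : {poly R}) = fun=> 0 by apply/funext => x; rewrite horner0.
  exact: generatedC.
have -> : horner (p * 'X + c%:P) = fun x => p.[x] * x + c.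
  by apply/funext => x; rewrite hornerMXaddC.
apply: generatedD; last exact: generatedC.
by apply: generatedM => //; exact: generatedV.
Qed.

Section example.
Context (R : realType) (r : R) (p : {poly R}).
Hypotheses (r0 : 0 < r) (p0 : forall x : R, 0 < p.[x]).

Let h : R -> R := c_hyperbola r.
Let E (x : R) : R := expR (x ^+ 2).
Let c2 (x : R) : R := c_hyperbola r x + c_oscillating p x.

Lemma hyperbola_radicand_gt0 x : 0 < 1 + r * x ^+ 2.
Proof. by rewrite ltr_wpDr// mulr_ge0 ?sqr_ge0// ltW. Qed.

Lemma c_hyperbola_gt0 x : 0 < c_hyperbola r x.
Proof. by rewrite sqrtr_gt0 hyperbola_radicand_gt0. Qed.

Lemma c_hyperbola_ge1 x : 1 <= c_hyperbola r x.
Proof.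
rewrite -[leLHS]sqrtr1 ler_wsqrtr// lerDl mulr_ge0 ?sqr_ge0//.
exact: ltW.
Qed.

Lemma is_derive_c_hyperbola (x : R) :
  is_derive x (1 : R) (c_hyperbola r) (r * x / c_hyperbola r x).
Proof.
have -> : c_hyperbola r = Num.sqrt \o (cst 1 + r \*: (id ^+ 2)) by [].
have rad : (cst 1 + r \*: (id ^+ 2)) x = 1 + r * x ^+ 2 :> R by [].
have dsqrt := is_derive1_sqrt (hyperbola_radicand_gt0 x).
rewrite -rad in dsqrt.
apply: is_derive_eq; rewrite !fctE /GRing.scale/= expr1.
by field; rewrite gt_eqF// c_hyperbola_gt0.
Qed.

Lemma is_derive_E (x : R) : is_derive x (1 : R) E (2 * x * E x).
Proof.
have -> : E = expR \o (id ^+ 2) by [].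
by apply: is_derive_eq; rewrite !fctE /GRing.scale/= expr1; ring.
Qed.

Lemma is_derive_sinE (x : R) :
  is_derive x (1 : R) (sin \o E) (2 * x * E x * cos (E x)).
Proof.
have dE := is_derive_E x; have dsin := is_derive_sin (E x).
by apply: is_derive_eq; ring.
Qed.

Lemma is_derive_cosE (x : R) :
  is_derive x (1 : R) (cos \o E) (- (2 * x * E x * sin (E x))).
Proof.
have dE := is_derive_E x; have dcos := is_derive_cos (E x).
by apply: is_derive_eq; ring.
Qed.

Lemma is_derive_invp (x : R) :
  is_derive x (1 : R) (fun y => p.[y]^-1) (- p^`().[x] / p.[x] ^+ 2).
Proof.
have dp := is_derive_poly p x; have px0 := lt0r_neq0 (p0 x).
have := is_deriveV px0 dp; move/is_derive_eq; apply.
by rewrite /GRing.scale/=; ring.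
Qed.

Lemma is_derive_invh (x : R) :
  is_derive x (1 : R) (fun y => (h y)^-1) (- (r * x) / h x ^+ 3).
Proof.
have dh := is_derive_c_hyperbola x; have hx0 := lt0r_neq0 (c_hyperbola_gt0 x).
have := is_deriveV hx0 dh; move/is_derive_eq; apply.
by rewrite /GRing.scale/= /h; move: hx0; move: (c_hyperbola r x) => a a0; field.
Qed.

(** Reciprocals are generators of their own because [generated_poly] has no division. The polynomial
    [p] and its derivative are obtained from [id]. *)
Let gens : list (R -> R) :=
  [:: id; E; sin \o E; cos \o E; h; fun x => (h x)^-1; fun x => p.[x]^-1].

Lemma gens_closed : closed_under_derivation gens.
Proof.
suff gens_cl g : List.In g gens -> exists dg,
    generated gens dg /\ forall x, is_derive x (1 : R) g (dg x).
  by move=> g /gens_cl[dg [[k [w dg_gen]] dgE]]; exists k, w, dg.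
have gx : generated gens id by apply: generatedV; left.
have gE : generated gens E by apply: generatedV; do 1 right; left.
have gS : generated gens (sin \o E) by apply: generatedV; do 2 right; left.
have gC : generated gens (cos \o E) by apply: generatedV; do 3 right; left.
have gh : generated gens h by apply: generatedV; do 4 right; left.
have gi : generated gens (fun x => (h x)^-1) by apply: generatedV; do 5 right; left.
have gq : generated gens (fun x => p.[x]^-1) by apply: generatedV; do 6 right; left.
have gc c := generatedC gens c.
have gdE : generated gens (fun x => 2 * x * E x).
  by do ?apply: generatedM.
case=> [<-|[<-|[<-|[<-|[<-|[<-|[<-|[]]]]]]]].
- by exists (fun=> 1); split=> // x; exact: is_derive_id.
- by exists (fun x => 2 * x * E x); split=> // x; exact: is_derive_E.
- exists (fun x => 2 * x * E x * cos (E x)); split; last exact: is_derive_sinE.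
  exact: generatedM.
- exists (fun x => -1 * (2 * x * E x * sin (E x))); split=> [|x].
    by apply: generatedM => //; exact: generatedM.
  by rewrite mulN1r; exact: is_derive_cosE.
- exists (fun x => r * x / h x); split; last exact: is_derive_c_hyperbola.
  by do ?apply: generatedM.
- exists (fun x => - r * x * ((h x)^-1 * (h x)^-1 * (h x)^-1)); split=> [|x].
    by do ?apply: generatedM.
  apply: is_derive_eq (is_derive_invh x) _.
  by field; rewrite gt_eqF// c_hyperbola_gt0.
- exists (fun x => -1 * p^`().[x] * (p.[x]^-1 * p.[x]^-1)); split=> [|x].
    apply: generatedM; last exact: generatedM.
    by apply: generatedM => //; apply: generated_horner; left.
  apply: is_derive_eq (is_derive_invp x) _.
  by field; rewrite gt_eqF.
Qed.

Lemma generated_c_hyperbola : generated gens (c_hyperbola r).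
Proof. by apply: generatedV; do 4 right; left. Qed.

Lemma generated_c2 : generated gens c2.
Proof.
apply: generatedD; first exact: generated_c_hyperbola.
apply: generatedM; last by apply: generatedV; do 6 right; left.
apply: generatedD; first exact: generatedC.
by apply: generatedV; do 2 right; left.
Qed.

Lemma c_oscillating_gt0 x : 0 < c_oscillating p x.
Proof.
apply: divr_gt0; last exact: p0.
by have := sin_geN1 (expR (x ^+ 2)); lra.
Qed.

Lemma c_hyperbola_proper A : exists N, forall x, N <= `|x| -> A < c_hyperbola r x.
Proof.
exists (`|A| / Num.sqrt r) => x Nx.
rewrite (le_lt_trans (ler_norm A))// -sqrtr_sqr ltr_sqrt ?hyperbola_radicand_gt0//.
have sr0 : 0 < Num.sqrt r by rewrite sqrtr_gt0.
(* The threshold for [x] amounts to [|A| <= sqrt r * |x|]; the summand 1 of the radicand then makes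
   the inequality strict. *)
have : A ^+ 2 <= r * x ^+ 2.
  rewrite -real_normK ?num_real// -(real_normK (num_real x)).
  rewrite -{1}(sqr_sqrtr (ltW r0)) -exprMn lerXn2r ?nnegrE ?mulr_ge0 ?sqrtr_ge0//.
  by rewrite mulrC -ler_pdivrMr.
lra.
Qed.

End example.

(** * Growth estimates and unboundedness of the critical points *)

Lemma horner_le_expR (R : realType) (p : {poly R}) (a : R) : 0 < a ->
  exists2 C : R, 0 <= C & forall x, 0 <= x -> `|p.[x]| <= C * expR (a * x).
Proof.
elim/poly_ind: p a => [|p c IH] a a0.
  by exists 0 => // x _; rewrite horner0 normr0 mul0r.
(* Half of the exponential rate absorbs [p], the other half absorbs the extra factor [x] through
   [1 + t <= expR t]. *)
have [|C C0 pC] := IH (a / 2); first by rewrite divr_gt0.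
exists (C * (2 / a) + `|c|) => [|x x0].
  by rewrite addr_ge0// mulr_ge0// divr_ge0// ltW.
rewrite hornerMXaddC (le_trans (ler_normD _ _))// mulrDl lerD//; last first.
  by rewrite ler_peMr// -expR0 ler_expR mulr_ge0// ltW.
rewrite normrM (ger0_norm x0).
have -> : expR (a * x) = expR (a / 2 * x) * expR (a / 2 * x).
  by rewrite -expRD; congr expR; field.
have -> : C * (2 / a) * (expR (a / 2 * x) * expR (a / 2 * x)) =
    C * expR (a / 2 * x) * (2 / a * expR (a / 2 * x)) by ring.
apply: ler_pM => //; first exact: pC.
have -> : x = 2 / a * (a / 2 * x) by field; rewrite gt_eqF.
rewrite ler_wpM2l ?divr_ge0 ?(ltW a0)//.
have -> : a / 2 * (2 / a * (a / 2 * x)) = a / 2 * x by field; rewrite gt_eqF.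
by have := expR_ge1Dx (a / 2 * x); lra.
Qed.

(** A negative leading coefficient would make [p] eventually negative, so the leading coefficient is
    positive and itself serves as the lower bound. *)
Lemma positive_horner_ge (R : realType) (p : {poly R}) :
  (forall x, 0 < p.[x]) ->
  exists2 m : R, 0 < m & exists N, forall x, N <= x -> m <= p.[x].
Proof.
move=> p0; have [lcp|lcp] := ltP 0 (lead_coef p).
  by exists (lead_coef p) => //; exact: poly_pinfty_gt_lc.
have p_neq0 : p != 0 by apply/eqP => pE; have := p0 0; rewrite pE horner0 ltxx.
have [|N pN] := @poly_pinfty_gt_lc R (- p).
  by rewrite lead_coefN oppr_gt0 lt_neqAle lcp lead_coef_eq0 p_neq0.
have := pN N (lexx _); rewrite lead_coefN hornerN lerN2 => pN'.
by have := lt_le_trans (p0 N) (le_trans pN' lcp); rewrite ltxx.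
Qed.

Section unbounded.
Context (R : realType) (r : R) (p : {poly R}).
Context (r0 : 0 < r) (p0 : forall x : R, 0 < p.[x]).

Let h : R -> R := c_hyperbola r.
Let E (x : R) : R := expR (x ^+ 2).
Let c2 (x : R) : R := c_hyperbola r x + c_oscillating p x.
Let dc2 (x : R) : R := r * x / h x +
  (2 * x * E x * cos (E x) * p.[x] - (2 + sin (E x)) * p^`().[x]) / p.[x] ^+ 2.

Lemma is_derive_c2 (x : R) : is_derive x (1 : R) c2 (dc2 x).
Proof.
have dh := is_derive_c_hyperbola r0 x.
have dS := is_derive_sinE x.
have dq := is_derive_invp p0 x.
have -> : c2 = c_hyperbola r + (cst 2 + (sin \o E)) * (fun x => p.[x]^-1) by [].
apply: is_derive_eq; rewrite /dc2 /h !fctE /GRing.scale/= /E.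
have := lt0r_neq0 (p0 x); move: (p.[x]) => a a0.
have := lt0r_neq0 (c_hyperbola_gt0 r0 x); move: (c_hyperbola r x) => b b0.
by field; rewrite a0 b0.
Qed.

(** Its purpose is the sign of [dc2] after multiplication by [p.[x] ^+ 2]; the coefficient 2 is the
    value of [2 + sin (E x)] where the sine vanishes. *)
Lemma oscillation_dominates : exists N, forall x, N <= x ->
  0 < x /\ r * x * p.[x] ^+ 2 + 2 * `|p^`().[x]| < 2 * x * E x * p.[x].
Proof.
have [m m0 [N1 pm]] := positive_horner_ge p0.
have [C C0 qC] := horner_le_expR (r *: ('X * p ^+ 2)) (@ltr01 R).
have [C' C'0 q'C] := horner_le_expR p^`() (@ltr01 R).
(* The thresholds give in turn [m <= p.[x]], then [x < x ^+ 2], then [C + 2 * C' <= m * x]. *)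
exists (Num.max N1 (Num.max 2 ((C + 2 * C') / m))) => x.
rewrite !ge_max => /and3P[N1x x2 xC].
have x0 : 0 < x by lra.
split=> //.
have px := pm x N1x.
have {}xC : C + 2 * C' <= m * x by rewrite [m * x]mulrC -ler_pdivrMr.
apply: (@le_lt_trans _ _ ((C + 2 * C') * expR x)).
  rewrite [leRHS]mulrDl; apply: lerD.
    have := qC x (ltW x0); rewrite mul1r; apply: le_trans.
    by rewrite !hornerE ?mulrA ler_norm.
  by rewrite -mulrA ler_wpM2l//; have := q'C x (ltW x0); rewrite mul1r.
have Ex : expR x < E x by rewrite ltr_expR expr2 ltr_pMl//; lra.
apply: (@le_lt_trans _ _ (m * x * expR x)); first by rewrite ler_wpM2r ?expR_ge0.
apply: (@lt_le_trans _ _ (m * x * E x)); first by rewrite ltr_pM2l ?mulr_gt0.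
have -> : 2 * x * E x * p.[x] = (2 * p.[x]) * x * E x by ring.
rewrite ler_pM2r ?expR_gt0// ler_pM2r//; lra.
Qed.

Lemma c2_smooth : smooth c2.
Proof.
have [k [w c2_gen]] := generated_c2 r p.
exact: generated_poly_smooth (gens_closed r0 p0) c2_gen.
Qed.

Lemma dc2_continuous : continuous dc2.
Proof.
have -> : dc2 = c2^`()%classic.
  apply/funext => x; rewrite derive1E.
  by rewrite (@derive_val _ _ _ _ _ _ _ (is_derive_c2 x)).
exact/smooth_continuous/smooth_derive/c2_smooth.
Qed.

(** For cosine 1 both summands of [dc2] are nonnegative and the second is positive. For cosine -1
    the first is at most [r * x], since [h >= 1], and the second lies below [- (r * x)]. *)
Lemma dc2_sign x : 0 < x ->
  r * x * p.[x] ^+ 2 + 2 * `|p^`().[x]| < 2 * x * E x * p.[x] ->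
  sin (E x) = 0 ->
  (cos (E x) = 1 -> 0 < dc2 x) /\ (cos (E x) = -1 -> dc2 x < 0).
Proof.
move=> x0 dom sE; rewrite /dc2 sE addr0.
have px := p0 x; have p2 : 0 < p.[x] ^+ 2 by rewrite exprn_gt0.
have hx : 0 <= r * x / h x.
  by rewrite divr_ge0 ?mulr_ge0 ?(ltW r0) ?(ltW x0)// ltW// c_hyperbola_gt0.
have hx' : r * x / h x <= r * x.
  rewrite ler_pdivrMr ?c_hyperbola_gt0// ler_peMr ?c_hyperbola_ge1//.
  by rewrite mulr_ge0 ?(ltW r0) ?(ltW x0).
have np := ler_norm p^`().[x]; have nNp := ler_norm (- p^`().[x]).
rewrite normrN in nNp.
have rp : 0 <= r * x * p.[x] ^+ 2 by rewrite !mulr_ge0 ?(ltW r0) ?(ltW x0) ?(ltW px).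
split=> ->.
  by rewrite ltr_wpDl// divr_gt0//; lra.
have : (2 * x * E x * -1 * p.[x] - 2 * p^`().[x]) / p.[x] ^+ 2 < - (r * x).
  by rewrite ltr_pdivrMr//; lra.
lra.
Qed.

(** The intermediate value theorem is applied to [dc2] between consecutive points where [E] is an
    odd and then an even multiple of [pi]. *)
Lemma critical_c2_unbounded (N : R) : exists2 x, N < x & is_derive x (1 : R) c2 0.
Proof.
have [N1 dom] := oscillation_dominates.
pose M := Num.max 0 (Num.max N N1) + 1.
have M0 : 0 < M.
  by rewrite ltr_wpDl// le_max lexx.
have [j Mj] : exists j : nat, E M < j%:R.
  by exists (Num.truncn (E M)).+1; exact: truncnS_gt.
have E_M1 : 1 <= E M by rewrite -expR0 ler_expR sqr_ge0.
(* This solves [E (x n) = pi *+ n] as soon as [1 < pi *+ n], so that the logarithm is nonnegative.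
   The index [j] ensures this, as well as [M < x n], for all [n >= j]. *)
pose x n : R := Num.sqrt (ln (pi *+ n)).
have xP n : (j <= n)%N -> M < x n /\ E (x n) = pi *+ n.
  move=> jn.
  have n_pi : E M < pi *+ n.
    apply: (lt_le_trans Mj); apply: (@le_trans _ _ n%:R); first by rewrite ler_nat.
    by rewrite -[pi *+ n]mulr_natr ler_peMl//; have := pi_ge2 R; lra.
  have pin1 : (1 : R) < pi *+ n by exact: le_lt_trans E_M1 n_pi.
  have ExE : E (x n) = pi *+ n.
    rewrite /E /x sqr_sqrtr ?lnK ?posrE//; first by rewrite (lt_trans ltr01).
    exact/ltW/ln_gt0.
  split=> //; rewrite ltNge; apply/negP => xM.
  have : E (x n) <= E M.
    by rewrite ler_expR lerXn2r ?nnegrE ?sqrtr_ge0// ltW.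
  by rewrite ExE leNgt n_pi.
have /xP[xo Eo] : (j <= j.*2.+1)%N by rewrite leqW// -addnn leq_addr.
have /xP[xe Ee] : (j <= j.*2.+2)%N by rewrite !leqW// -addnn leq_addr.
have MN : N < M by rewrite ltr_pwDr// !le_max lexx !orbT.
have MN1 : N1 <= M by rewrite ler_wpDr// !le_max lexx !orbT.
have trig n : sin (pi *+ n) = 0 :> R /\ cos (pi *+ n) = (-1) ^+ n :> R.
  (* Adding 0 exposes a shift by [n] half-periods, each of which flips the sign. *)
  rewrite -[pi *+ n]add0r (alternatingn (@sinDpi R)) (alternatingn (@cosDpi R)).
  by rewrite sin0 cos0 mulr0 mulr1.
have sgn n : M < x n -> E (x n) = pi *+ n ->
    ((-1) ^+ n = 1 :> R -> 0 < dc2 (x n)) /\ ((-1) ^+ n = -1 :> R -> dc2 (x n) < 0).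
  move=> Mx Ex; have [sn cn] := trig n.
  have [xn0 xn_dom] := dom (x n) (le_trans MN1 (ltW Mx)).
  by have := dc2_sign xn0 xn_dom; rewrite Ex sn cn; apply.
have neg : dc2 (x j.*2.+1) < 0.
  by apply: (sgn _ xo Eo).2; rewrite -signr_odd/= odd_double expr1.
have pos : 0 < dc2 (x j.*2.+2).
  by apply: (sgn _ xe Ee).1; rewrite -signr_odd/= odd_double.
have lt_x : x j.*2.+1 <= x j.*2.+2.
  rewrite leNgt; apply/negP => ltx.
  have : E (x j.*2.+2) <= E (x j.*2.+1).
    by rewrite ler_expR lerXn2r ?nnegrE ?sqrtr_ge0// ltW.
  by rewrite Eo Ee mulrS gerDr leNgt pi_gt0.
have [||c] := @IVT R dc2 _ _ 0 lt_x.
- exact/continuous_subspaceT/dc2_continuous.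
- by rewrite ge_min le_max (ltW neg) (ltW pos) orbT.
rewrite in_itv/= => /andP[xc _] dc0; exists c.
  by rewrite (lt_trans MN)// (lt_le_trans xo).
by rewrite -dc0; exact: is_derive_c2.
Qed.

Lemma c_hyperbola_smooth : smooth (c_hyperbola r).
Proof.
have [k [w h_gen]] := generated_c_hyperbola r p.
exact: generated_poly_smooth (gens_closed r0 p0) h_gen.
Qed.

Lemma critical_set_c_hyperbola : critical_set (c_hyperbola r) = [set 0].
Proof.
apply/seteqP; split=> [x /= dx|_ ->]; last first.
  by apply: is_derive_eq (is_derive_c_hyperbola r0 0) _; rewrite mulr0 mul0r.
have := @derive_val _ _ _ _ _ _ _ dx.
rewrite (@derive_val _ _ _ _ _ _ _ (is_derive_c_hyperbola r0 x)) => /eqP.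
by rewrite !mulf_eq0 invr_eq0 (gt_eqF r0) (gt_eqF (c_hyperbola_gt0 r0 x)) orbF => /eqP.
Qed.

Lemma limit_point_critical_c2 : limit_point (critical_set c2) = set0.
Proof.
have [k [w c2_gen]] := generated_c2 r p.
(* Divergence of the hyperbola provides a point where [c2] exceeds [c2 0], so [c2] is not
   constant. *)
have [N hN] := c_hyperbola_proper r0 (c2 0).
apply: (@gevrey_critical_set _ _ 0 `|N| c2_smooth).
  exact: generated_poly_derive_gevrey (gens_closed r0 p0) c2_gen.
apply/eqP; rewrite lt_eqF// (lt_le_trans (hN `|N| _))//.
  by rewrite normr_id ler_norm.
by rewrite lerDl ltW// c_oscillating_gt0.
Qed.

End unbounded.

(** * Properness and assembly of the four properties *)

Lemma limit_point_set1 (R : realType) (x : R) : limit_point [set x] = set0.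
Proof.
apply/seteqP; split=> // y /limit_point_infinite_setP /(_ setT).
by rewrite setTI => /(_ filterT); apply.
Qed.

Lemma norm_ge_cvg_pinfty (R : realType) (f : R -> R) :
  (forall A : R, exists N : R, forall x, N <= `|x| -> A < f x) ->
  (f x @[x --> -oo] --> +oo) /\ (f x @[x --> +oo] --> +oo).
Proof.
move=> f_big; split; apply/cvgryPge => A; have [N fN] := f_big A.
- near=> x; apply/ltW/fN; rewrite -normrN; apply: le_trans (ler_norm _).
  by rewrite lerNr; near: x; apply: nbhs_ninfty_le; exact: num_real.
- near=> x; apply/ltW/fN; apply: le_trans (ler_norm _).
  by near: x; apply: nbhs_pinfty_ge; exact: num_real.
Unshelve. all: by end_near. Qed.

Lemma proper_norm_le (R : realType) (f : R -> R) :
  (forall A : R, exists N : R, forall x, N <= `|x| -> A < f x) ->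
  forall M : R, exists N : R, forall x, `|f x| <= M -> `|x| <= N.
Proof.
move=> f_big M; have [N fN] := f_big M; exists N => x fx.
rewrite leNgt; apply/negP => /ltW /fN; rewrite ltNge => /negP; apply.
exact: le_trans (ler_norm _) fx.
Qed.

Unset Implicit Arguments.

Theorem theorem4 (R : realType) (r : R) (hr : 0 < r) (p : {poly R})
    (p_nonconstant : exists x y : R, p.[x] <> p.[y])
    (p_positive : forall x : R, 0 < p.[x]) :
  let c1 : R -> R := c_hyperbola r in
  let c2 : R -> R := fun x => c_hyperbola r x + c_oscillating p x in
  [/\ [/\ TS_function c1, TS_function c2,
          (forall x : R, c1 x < c2 x),
          discrete_subset
            (c1 @` critical_set c1 `|` c2 @` critical_set c2) &
          closed (c1 @` critical_set c1 `|` c2 @` critical_set c2)],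
      ~ bounded_set (critical_set c1 `|` critical_set c2),
      (c1 x @[x --> -oo] --> +oo) /\ (c2 x @[x --> -oo] --> +oo) &
      (c1 x @[x --> +oo] --> +oo) /\ (c2 x @[x --> +oo] --> +oo)].
Proof.
move=> c1 c2.
have c1_lt_c2 x : c1 x < c2 x by rewrite ltrDl c_oscillating_gt0.
have c1_big (A : R) : exists N : R, forall x, N <= `|x| -> A < c1 x.
  exact: c_hyperbola_proper.
have c2_big (A : R) : exists N : R, forall x, N <= `|x| -> A < c2 x.
  have [N c1N] := c1_big A; exists N => x /c1N c1x.
  exact: lt_trans (c1_lt_c2 x).
have [c1_minfty c1_pinfty] := norm_ge_cvg_pinfty c1_big.
have [c2_minfty c2_pinfty] := norm_ge_cvg_pinfty c2_big.
have lim1 : limit_point (critical_set c1) = set0.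
  by rewrite (critical_set_c_hyperbola hr) limit_point_set1.
have lim2 : limit_point (critical_set c2) = set0.
  exact: limit_point_critical_c2.
(* Discreteness and closedness of the critical values both follow from this. *)
have lim12 : limit_point (c1 @` critical_set c1 `|` c2 @` critical_set c2) = set0.
  by apply: limit_point_setU; apply: image_no_limit_point => //;
    exact: proper_norm_le.
split=> //.
  split=> //.
  - exact: TS_function_no_limit_point (c_hyperbola_smooth hr p_positive) lim1.
  - exact: TS_function_no_limit_point (c2_smooth hr p_positive) lim2.
  - exact: no_limit_point_isolated.
  - exact: no_limit_point_closed.
(* In [bounded_set] every number strictly above [M] is a bound; [|M| + 1] is one, and a critical
   point of [c2] beyond it contradicts this. *)
move=> [M [_ M_bounds]].
have [x Mx dc2x] := critical_c2_unbounded hr p_positive (`|M| + 1).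
have M1 : M < `|M| + 1 by rewrite (le_lt_trans (ler_norm M))// ltrDl.
have /= := M_bounds _ M1 x (or_intror dc2x).
by rewrite leNgt (lt_le_trans Mx (ler_norm x)).
Qed.
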